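(* Let $q$ be a prime power, let $p_1\neq p_2$ be points of $\mathbb{P}^2(\overline{\mathbb{F}}_q)$ such that $p_i$ is a $q^{n_i}$-point for $i=1,2$, and let the line $\ell=\langle p_1,p_2\rangle$ be a $q^k$-line. Then $k\mid\operatorname{lcm}(n_1,n_2)$, and for each $i\in\{1,2\}$ either $n_i\mid k$ or $k\mid n_i$.
   Context: Let $f=\mathrm{Frob}_q$ act on $\mathbb{P}^2(\overline{\mathbb{F}}_q)$ by raising coordinates to the $q$th power, and correspondingly on lines. A point (respectively line) whose $f$-orbit has exactly $n$ elements is called a $q^n$-point (respectively $q^n$-line). For distinct points $p_1,p_2$, $\langle p_1,p_2\rangle$ is the unique line containing both. *)

(* Defs.v *)
From HB Require Import structures.
From mathcomp Require Import all_boot all_algebra all_field.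

Set Implicit Arguments.
Unset Strict Implicit.
Unset Printing Implicit Defensive.

Import GRing.Theory.
Local Open Scope ring_scope.

(* K is an algebraic closure of F through the embedding iota; algebraic
   closedness is carried by the type of K. *)
Definition is_alg_closure (F : fieldType) (K : closedFieldType)
    (iota : {rmorphism F -> K}) : Prop :=
  forall z : K, algebraicOver iota z.

(* The set {f^i(x) | i >= 0} has exactly n elements. *)
Definition orbit_has_size (T : eqType) (f : T -> T) (x : T) (n : nat) : Prop :=
  exists s : seq T,
    [/\ uniq s, size s = n & forall y, y \in s <-> exists i, y = iter i f x].

Section ProjectivePlane.
Variable K : fieldType.
Implicit Types (q n : nat) (U V P L : {vspace 'rV[K]_3}).

(* P^2(K) is the projective space of K^3: its points (resp. lines) are the
   vector subspaces of K^3 of dimension 1 (resp. 2), incidence is inclusion,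
   and the point [x : y : z] is the vector line spanned by (x, y, z). *)
Definition is_point U : Prop := \dim U = 1%N.
Definition is_line U : Prop := \dim U = 2%N.

Definition frob_vec q (v : 'rV[K]_3) : 'rV[K]_3 := \row_j (v 0 j ^+ q).

(* The image of U under v |-> frob_vec q v, see mem_frob; as that map is only
   semilinear, limg does not apply. *)
Definition frob q U : {vspace 'rV[K]_3} :=
  <<[seq frob_vec q v | v <- vbasis U]>>%VS.

Definition is_qpoint q n U : Prop :=
  is_point U /\ orbit_has_size (frob q) U n.
Definition is_qline q n U : Prop :=
  is_line U /\ orbit_has_size (frob q) U n.

Definition join P Q : {vspace 'rV[K]_3} := (P + Q)%VS.

Lemma join_is_line P Q : is_point P -> is_point Q -> P <> Q ->
  is_line (join P Q).
Proof.
rewrite /is_point /is_line /join => dP dQ neq.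
have /eqP d0 : \dim (P :&: Q) == 0%N.
  have := dimvS (capvSl P Q); rewrite dP leq_eqVlt ltnS leqn0.
  case/orP=> // /eqP d1; case: neq.
  have /eqP eP : (P :&: Q)%VS == P by rewrite eqEdim capvSl dP d1.
  have /eqP eQ : (P :&: Q)%VS == Q by rewrite eqEdim capvSr dQ d1.
  exact: etrans (esym eP) eQ.
by have := dimv_sum_cap P Q; rewrite d0 addn0 dP dQ.
Qed.

Lemma join_unique P Q L : is_point P -> is_point Q -> P <> Q -> is_line L ->
  ((P <= L) && (Q <= L))%VS <-> L = join P Q.
Proof.
move=> dP dQ neq dL; split=> [|->]; last by rewrite addvSl addvSr.
rewrite -subv_add => sub; apply/esym/eqP.
by rewrite eqEdim sub (join_is_line dP dQ neq) dL.
Qed.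

End ProjectivePlane.

Lemma card_pnat_pchar (F : finFieldType) (K : fieldType)
  (iota : {rmorphism F -> K}) : [pchar K].-nat #|F|.
Proof.
have [p p_pr pF] := finPcharP F.
have pK : p \in [pchar K] by rewrite (fmorph_pchar iota).
by rewrite (eq_pnat _ (pcharf_eq pK)) (card_pprimeChar pF) pnatX pnat_id.
Qed.

Section FrobImage.
Variables (K : closedFieldType) (q : nat).
Hypothesis qP : [pchar K].-nat q.
Implicit Types (U : {vspace 'rV[K]_3}) (u v : 'rV[K]_3).

Lemma q_gt0 : (0 < q)%N.
Proof. by case/andP: qP. Qed.

Lemma frob_vecD u v : frob_vec q (u + v) = frob_vec q u + frob_vec q v.
Proof. by apply/rowP=> j; rewrite !mxE exprDn_pchar. Qed.

Lemma frob_vecZ (a : K) u : frob_vec q (a *: u) = a ^+ q *: frob_vec q u.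
Proof. by apply/rowP=> j; rewrite !mxE exprMn. Qed.

Lemma frob_vec0 : frob_vec q (0 : 'rV[K]_3) = 0.
Proof. by apply/rowP=> j; rewrite !mxE expr0n gtn_eqF // q_gt0. Qed.

Lemma frob_vec_sum I (r : seq I) (G : I -> 'rV[K]_3) :
  frob_vec q (\sum_(i <- r) G i) = \sum_(i <- r) frob_vec q (G i).
Proof. exact: (big_morph _ frob_vecD frob_vec0). Qed.

Lemma exists_qroot (a : K) : exists b : K, b ^+ q = a.
Proof.
have q0 : (0 < q)%N := q_gt0.
have [b] := @solve_monicpoly K q (fun i => if i == 0%N then a else 0) q0.
rewrite -(prednK q0) big_ord_recl /= expr0 mulr1 big1 ?addr0 => [<-|i _].
  by exists b.
by rewrite mul0r.
Qed.

Lemma mem_frob U v :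
  v \in frob q U <-> exists2 u, u \in U & v = frob_vec q u.
Proof.
split=> [|[u uU ->]].
  rewrite /frob => /(@coord_span _ _ _ (map_tuple _ _)) ->.
  set c := coord _.
  have [b bP] : exists b : 'I_(\dim U) -> K, forall i, b i ^+ q = c i v.
    have ex i : exists b, b ^+ q == c i v.
      by have [b <-] := exists_qroot (c i v); exists b.
    by exists (fun i => xchoose (ex i)) => i; apply/eqP; exact: (xchooseP (ex i)).
  exists (\sum_i b i *: (vbasis U)`_i).
    apply: memv_suml => i _; apply/memvZ/vbasis_mem/mem_nth.
    by rewrite size_tuple.
  rewrite frob_vec_sum; apply: eq_bigr => i _.
  by rewrite frob_vecZ bP (nth_map 0) // size_tuple.
rewrite (coord_vbasis uU) frob_vec_sum; apply: memv_suml => i _.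
rewrite frob_vecZ; apply/memvZ/memv_span/map_f/mem_nth.
by rewrite size_tuple.
Qed.

Lemma frob_point v : frob q <[v]> = <[frob_vec q v]>%VS.
Proof.
apply/vspaceP=> w; apply/idP/idP.
  by case/mem_frob=> u /vlineP[a ->] ->; rewrite frob_vecZ memvZ // memv_line.
case/vlineP=> a ->; have [b <-] := exists_qroot a; rewrite -frob_vecZ.
by apply/mem_frob; exists (b *: v) => //; rewrite memvZ // memv_line.
Qed.

End FrobImage.

(* Main.v *)
(* Frobenius permutes the subspaces of K^3 injectively, respecting sums and
   intersections, so f^m fixes a subspace iff its orbit size divides m.  As f^m
   with m = lcm(n1, n2) fixes p1 and p2, it fixes their join, hence k | m.  If a
   q^n-point p lies on the q^k-line l, either f^n fixes l, and k | n, or p is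
   the intersection of l and f^n(l), which f^k fixes, and n | k. *)
Require Import Defs.
From HB Require Import structures.
From mathcomp Require Import all_boot all_algebra all_field.

Lemma iter_fixed_dvdn (T : eqType) (f : T -> T) (x : T) (n m : nat) :
  injective f -> orbit_has_size f x n -> iter m f x = x <-> n %| m.
Proof.
move=> injf [s [us sz memP]].
have iter_mem i : iter i f x \in s by apply/memP; exists i.
have loopn : looping f x n.
  apply: contraT; rewrite -looping_uniq => /uniq_leq_size le_s.
  have /le_s : {subset traject f x n.+1 <= s} by move=> _ /trajectP[i _ ->].
  by rewrite size_traject sz ltnn.
have sub : {subset s <= traject f x n}.
  by move=> y /memP[i ->]; apply/loopingP.
have ut : uniq (traject f x n).
  by rewrite (leq_size_uniq us sub) // size_traject sz.
have n_gt0 : 0 < n by rewrite -sz; case: (s) (iter_mem 0).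
have fixed_lt i : i < n -> iter i f x = x -> i = 0.
  move=> lt_in fx; apply/eqP.
  by rewrite -(nth_uniq x _ _ ut) ?size_traject // !nth_traject //= fx.
have fixn : iter n f x = x.
  have /trajectP[[|i] lt_in eq_i] := loopn => //.
  move: eq_i; rewrite -{1}(subnKC (ltnW lt_in)) iterD.
  have inj_iter j : injective (iter j f).
    by elim: j => [|j IHj] u v //= /injf /IHj.
  move=> /inj_iter /fixed_lt.
  rewrite ltn_subrL n_gt0 => /(_ isT) /eqP.
  by rewrite subn_eq0 leqNgt lt_in.
have fix_mul j : iter (j * n) f x = x.
  by elim: j => [|j IHj] //; rewrite mulSn iterD IHj.
split=> [|/dvdnP[j ->] //].
rewrite {1}(divn_eq m n) addnC iterD fix_mul => /fixed_lt.
by rewrite ltn_pmod // /dvdn => /(_ isT) ->.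
Qed.

Section FrobLattice.
Import GRing.Theory.
Local Open Scope ring_scope.
Variables (K : closedFieldType) (q : nat).
Hypothesis qP : [pchar K].-nat q.
Implicit Types U V P L : {vspace 'rV[K]_3}.

Lemma frob_vec_inj : injective (@frob_vec K q).
Proof.
move=> u v eq_uv; apply/eqP; rewrite -subr_eq0; apply/eqP/rowP=> j.
have /rowP/(_ j) : frob_vec q (u - v) = 0.
  apply: (addIr (frob_vec q v)).
  by rewrite -(frob_vecD qP) subrK add0r.
rewrite [LHS]mxE [RHS]mxE => /eqP.
by rewrite expf_eq0 => /andP[_ /eqP ->]; rewrite mxE.
Qed.

Lemma mem_frob_vec U v : (frob_vec q v \in frob q U) = (v \in U).
Proof.
apply/idP/idP=> [/(mem_frob qP)[u uU /frob_vec_inj -> //]|vU].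
by apply/(mem_frob qP); exists v.
Qed.

Lemma frob_inj : injective (@frob K q).
Proof.
move=> U V eqUV; apply/vspaceP=> v.
by rewrite -mem_frob_vec eqUV mem_frob_vec.
Qed.

Lemma frobI U V : frob q (U :&: V) = (frob q U :&: frob q V)%VS.
Proof.
apply/vspaceP=> w; rewrite memv_cap; apply/idP/andP.
  by case/(mem_frob qP)=> u /[!memv_cap] /andP[uU uV] ->; rewrite !mem_frob_vec.
case=> /(mem_frob qP)[u uU ->].
by rewrite !mem_frob_vec memv_cap uU.
Qed.

Lemma frobD U V : frob q (U + V) = (frob q U + frob q V)%VS.
Proof.
apply/vspaceP=> w; apply/idP/idP.
  case/(mem_frob qP)=> _ /memv_addP[u uU [v vV ->]] ->.
  by rewrite (frob_vecD qP) memv_add // mem_frob_vec.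
case/memv_addP=> _ /(mem_frob qP)[u uU ->] [_ /(mem_frob qP)[v vV ->] ->].
by rewrite -(frob_vecD qP) mem_frob_vec memv_add.
Qed.

Lemma iter_frobI m U V :
  iter m (frob q) (U :&: V)%VS = (iter m (frob q) U :&: iter m (frob q) V)%VS.
Proof. by elim: m => //= m ->; rewrite frobI. Qed.

Lemma iter_frobD m U V :
  iter m (frob q) (U + V)%VS = (iter m (frob q) U + iter m (frob q) V)%VS.
Proof. by elim: m => //= m ->; rewrite frobD. Qed.

Lemma dim_iter_frob m U : (\dim (iter m (frob q) U) <= \dim U)%N.
Proof.
elim: m => //= m; apply: leq_trans; apply: leq_trans (dim_span _) _.
by rewrite size_map size_tuple.
Qed.

Lemma qpoint_on_qline n k P L :
  is_qpoint q n P -> is_qline q k L -> (P <= L)%VS -> (n %| k)%N \/ (k %| n)%N.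
Proof.
move=> [dP oP] [dL oL] PL.
have fixP m := iter_fixed_dvdn _ _ _ _ m frob_inj oP.
have fixL m := iter_fixed_dvdn _ _ _ _ m frob_inj oL.
have fnP : iter n (frob q) P = P by apply/fixP.
have fkL : iter k (frob q) L = L by apply/fixL.
have [/fixL|neq] := eqVneq (iter n (frob q) L) L; first by right.
have PnL : (P <= iter n (frob q) L)%VS.
  by apply/capv_idPl; rewrite -{1}fnP -iter_frobI (capv_idPl PL).
left; apply/fixP.
suff -> : P = (L :&: iter n (frob q) L)%VS.
  by rewrite iter_frobI -iterD addnC iterD !fkL.
apply/eqP; rewrite eqEdim subv_cap PL PnL dP leqNgt.
apply: contra neq => dcap.
have LnL : (L <= iter n (frob q) L)%VS.
  by apply/capv_idPl/eqP; rewrite eqEdim capvSl dL.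
by rewrite eq_sym eqEdim LnL dim_iter_frob.
Qed.

End FrobLattice.

Theorem lemma4p2 (q : nat) (F : finFieldType) (hq : #|F| = q)
  (K : closedFieldType) (iota : {rmorphism F -> K})
  (hK : is_alg_closure iota)
  (n1 n2 k : nat) (p1 p2 : {vspace 'rV[K]_3})
  (hne : p1 <> p2)
  (hp1 : is_qpoint q n1 p1) (hp2 : is_qpoint q n2 p2)
  (hl : is_qline q k (join p1 p2)) :
  [/\ k %| lcmn n1 n2,
      (n1 %| k) \/ (k %| n1) &
      (n2 %| k) \/ (k %| n2)].
Proof.
have qP : [pchar K]%R.-nat q by rewrite -hq; apply: card_pnat_pchar iota.
have fixP x n m := iter_fixed_dvdn _ _ x n m (frob_inj _ _ qP).
split.
- apply/(fixP _ _ _ hl.2); rewrite /join iter_frobD //.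
  have /(fixP _ _ _ hp1.2) -> := dvdn_lcml n1 n2.
  by have /(fixP _ _ _ hp2.2) -> := dvdn_lcmr n1 n2.
- exact: qpoint_on_qline hp1 hl (addvSl _ _).
- exact: qpoint_on_qline hp2 hl (addvSr _ _).
Qed.
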